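(* Let $\lambda>0$ and let $a:=((a_{i,l})_{1\le i\le N},(a_{j,r})_{1\le j\le M})$ be a finite two-faced family of self-adjoint elements in a $C^*$-probability space $(\mathcal{A},\varphi)$. If the tuple $(a_{1,l},\dots,a_{N,l},a_{1,r},\dots,a_{M,r})$ has an almost sure random matrix model, and $a_{i,l}a_{j,r}=a_{j,r}a_{i,l}$ for $i=1,\dots,N$ and $j=1,\dots,M$, then there exist a subsequence $\alpha(n)$ of the natural numbers and, for each $n\in\mathbb{N}$, an $\alpha(n)\times\alpha(n)$ random two-faced family $Z(n):=((Z_{n,i,l})_{1\le i\le N},(Z_{n,j,r})_{1\le j\le M})$ of matrices such that $Z(n)$ converges in distribution, as $n\to\infty$, to the compound bi-free Poisson distribution determined by $\lambda$ and $\mu_a$, the distribution of $a$.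
   Context: A non-commutative probability space $(\mathcal{A},\varphi)$ is a unital complex algebra with a unital linear functional; it is a $C^*$-probability space if $\mathcal{A}$ is a unital $C^*$-algebra and $\varphi$ is a state. A two-faced family is a family of elements of $\mathcal{A}$ split into left variables (index set $I$) and right variables (index set $J$, disjoint from $I$); here $I=\{(i,l):1\le i\le N\}$ and $J=\{(j,r):1\le j\le M\}$. Its distribution is the collection of its joint moments; convergence in distribution means convergence of all joint moments. Almost sure random matrix model. A sequence of $K$-tuples $\{X(1,n),\dots,X(K,n)\}$ of $n\times n$ random matrices on a probability space $(\Omega,P)$ is an almost sure random matrix model of a $K$-tuple $(c_1,\dots,c_K)$ in a non-commutative probability space if for almost all $\omega\in\Omega$ the tuple $\{X(1,n,\omega),\dots,X(K,n,\omega)\}\subset(M_n(\mathbb{C}),tr_n)$ converges in distribution to $(c_1,\dots,c_K)$ as $n\to\infty$, $tr_n$ being the normalized trace. Random two-faced families of matrices. Let $(\Omega,P)$ be a probability space, $\mathcal{X}=L^{\infty-}(\Omega,P)=\bigcap_{p\ge1}L^p(\Omega,P)$ with $E$ the expectation, so $\mathcal{X}=\mathbb{C}1\oplus\ker E$. For $d\in\mathbb{N}$ let $\mathcal{X}_d=M_d(\mathcal{X})$ and let $\mathcal{L}(\mathcal{X}_d)$ be the algebra of linear operators on $\mathcal{X}_d$. Elements of $L^{\infty-}(\Omega,P)$ act on $\mathcal{X}$ by multiplication. For $T=[T_{i,j}]\in M_d(L^{\infty-}(\Omega,P))$, define $L(T),R(T)\in\mathcal{L}(\mathcal{X}_d)$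 by $$L(T)[\eta_{i,j}]=\Big[\sum_{k=1}^dT_{i,k}\eta_{k,j}\Big],\qquad R(T)[\eta_{i,j}]=\Big[\sum_{k=1}^dT_{k,j}\eta_{i,k}\Big].$$ These are called left and right matrices, respectively. A $d\times d$ random two-faced family of matrices is a two-faced family whose left members are left matrices $L(T)$ and whose right members are right matrices $R(T)$, with entries of $T$ in $L^{\infty-}(\Omega,P)$. Its distribution is taken with respect to $\Phi=tr\circ E_{\mathcal{L}(\mathcal{X}_d)}$ on $\mathcal{L}(\mathcal{X}_d)$, where $E_{\mathcal{L}(\mathcal{X}_d)}(A)=[E((A1_d)_{i,j})]\in M_d(\mathbb{C})$, $1_d$ is the diagonal matrix in $\mathcal{X}_d$ with the constant function $1$ on the diagonal, and $tr$ is the normalized trace. Bi-free cumulants. For $\chi:\{1,\dots,n\}\to I\sqcup J$, call the position $k$ left if $\chi(k)\in I$ and right if $\chi(k)\in J$. If the left positions are $i_1<\dots<i_p$ and the right positions are $i_{p+1}>\dots>i_n$, let $s_\chi(k)=i_k$ and $BNC(\chi)=\{s_\chi\cdot\pi:\pi\in NC(n)\}$, where $NC(n)$ is the set of non-crossing partitions of $\{1,\dots,n\}$ and $s_\chi\cdot\pi=\{s_\chi(V):V\in\pi\}$. The bi-free cumulants $\kappa_\chi:\mathcal{B}^n\to\mathbb{C}$ of a non-commutative probability space $(\mathcal{B},\psi)$ are the multilinear functionals determined recursively by $$\psi(b_1\cdots b_n)=\sum_{\pi\in BNC(\chi)}\ \prod_{V\in\pi}\kappa_{\chi|_V}\big((b_1,\dots,b_n)|_V\big),$$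 where for $V=\{v_1<\dots<v_k\}$ one sets $(b_1,\dots,b_n)|_V=(b_{v_1},\dots,b_{v_k})$ and $\chi|_V$ is viewed as a map on $\{1,\dots,k\}$. A two-faced family $((z_k)_{k\in I},(z_k)_{k\in J})$ has the compound bi-free Poisson distribution determined by $\lambda>0$ and the distribution of $a=((a_k)_{k\in I},(a_k)_{k\in J})$ if $\kappa_\chi(z_{\chi(1)},\dots,z_{\chi(n)})=\lambda\,\varphi(a_{\chi(1)}\cdots a_{\chi(n)})$ for every $n\in\mathbb{N}$ and $\chi:\{1,\dots,n\}\to I\sqcup J$. *)

(* Defs.v *)
From HB Require Import structures.
From mathcomp Require Import all_boot all_order all_algebra.
From mathcomp Require Import generic_quotient ring_quotient.
From mathcomp Require Import all_classical all_reals all_analysis.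
From mathcomp Require Import measurable_realfun complex.
Import Order.TTheory GRing.Theory Num.Theory.
Import numFieldNormedType.Exports.
Import ComplexField.Normc.
Set Implicit Arguments. Unset Strict Implicit. Unset Printing Implicit Defensive.
Local Open Scope ring_scope.

Section noncrossing.
Local Open Scope nat_scope.

Definition NC n : {set {set {set 'I_n}}} :=
  [set pi | finset.partition pi [set: 'I_n] &&
    [forall V in pi, forall W in pi,
     forall a in V, forall b in W, forall c in V, forall d in W,
       [&& a < b, b < c & c < d] ==> (V == W)]].

(* The left face is indexed by I (constructor inl), the right face by J. *)
Definition is_left I J (k : I + J) : bool := if k is inl _ then true else false.

Definition s_seq I J n (chi : 'I_n -> I + J) : seq 'I_n :=
  [seq k <- enum 'I_n | is_left (chi k)] ++
  rev [seq k <- enum 'I_n | ~~ is_left (chi k)].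

(* Positions are counted from 0: s_chi enumerates the left positions increasingly,
   then the right positions decreasingly. *)
Definition s_chi I J n (chi : 'I_n -> I + J) (k : 'I_n) : 'I_n :=
  nth k (s_seq chi) k.

Definition BNC I J n (chi : 'I_n -> I + J) : {set {set {set 'I_n}}} :=
  [set [set [set s_chi chi k | k in V] | V : {set 'I_n} in pi] |
    pi : {set {set 'I_n}} in NC n].

Lemma s_chi_surj I J n (chi : 'I_n -> I + J) i : exists k, s_chi chi k = i.
Proof.
have sz : size (s_seq chi) = n.
  rewrite size_cat size_rev !size_filter -[RHS]size_enum_ord.
  exact: count_predC.
have ii : i \in s_seq chi.
  rewrite mem_cat mem_rev (mem_filter (fun k => is_left (chi k))).
  by rewrite (mem_filter (fun k => ~~ is_left (chi k))) mem_enum !andbT orbN.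
have lt : index i (s_seq chi) < n by rewrite -[X in _ < X]sz index_mem.
by exists (Ordinal lt); rewrite /s_chi /= nth_index.
Qed.

Lemma s_chi_setT I J n (chi : 'I_n -> I + J) :
  [set s_chi chi k | k in [set: 'I_n]] = [set: 'I_n].
Proof.
apply/setP => i; rewrite inE; apply/imsetP.
by have [k <-] := s_chi_surj chi i; exists k.
Qed.

Lemma NC_setT n : 0 < n -> [set [set: 'I_n]] \in NC n.
Proof.
move=> n0; rewrite inE; apply/andP; split.
  rewrite /finset.partition cover1 eqxx finset.trivIset1 /=.
  apply/set1P => /setP/(_ (Ordinal n0)).
  by rewrite !inE.
apply/'forall_implyP => V /set1P ->; apply/'forall_implyP => W /set1P ->.
by do 4! (apply/'forall_implyP => ? _); rewrite eqxx implybT.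
Qed.

Lemma BNC_setT I J n (chi : 'I_n -> I + J) : 0 < n ->
  [set [set: 'I_n]] \in BNC chi.
Proof.
move=> n0; apply/imsetP; exists [set [set: 'I_n]]; first exact: NC_setT.
by rewrite imset_set1 s_chi_setT.
Qed.

Lemma BNC_card I J n (chi : 'I_n -> I + J) pi V :
  pi \in BNC chi -> pi != [set [set: 'I_n]] -> V \in pi -> 0 < #|V| < n.
Proof.
move=> /imsetP[rho]; rewrite inE => /andP[/and3P[/eqP covT tI n0] _] ->.
move=> neT /imsetP[W Wrho ->].
have W0 : W != finset.set0 by apply: contraNneq n0 => <-.
rewrite card_gt0 imset_eq0 W0 /= ltn_neqAle -[X in _ <= X]card_ord max_card andbT.
apply: contraNneq neT => cardW.
have WT : W = [set: 'I_n].
  apply/eqP; rewrite eqEcard finset.subsetT cardsT card_ord -{1}cardW.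
  exact: leq_imset_card.
have -> : rho = [set W].
  apply/setP => U; rewrite inE; apply/idP/eqP => [Urho|->//].
  apply/eqP; apply: contraNT n0 => UW.
  have /finset.trivIsetP/(_ U W Urho Wrho UW) := tI.
  rewrite WT -finset.setI_eq0 finset.setIT => /eqP <-.
  exact: Urho.
by rewrite imset_set1 WT s_chi_setT.
Qed.

End noncrossing.

Section cumulants.
Context (R : realType) (B : pzRingType) (psi : B -> R[i]).

(* The moment-cumulant formula solved for the term of the one-block partition;
   the fuel m bounds the recursion depth and is irrelevant as soon as n <= m
   (see bifree_moment_cumulant). The increasing bijection from 'I_#|V| onto the
   block V is enum_val. *)
Fixpoint cumulant_rec I J (m n : nat) (chi : 'I_n -> I + J) (b : 'I_n -> B) :
    R[i] :=
  if m is m'.+1 then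
    psi (\prod_(k < n) b k) -
    \sum_(pi in BNC chi | pi != [set [set: 'I_n]])
      \prod_(V in pi)
        @cumulant_rec I J m' #|V| (chi \o enum_val) (b \o enum_val)
  else 0.

Definition bifree_cumulant I J n (chi : 'I_n -> I + J) (b : 'I_n -> B) : R[i] :=
  cumulant_rec n chi b.

Lemma cumulant_rec_fuel I J (m n : nat) (chi : 'I_n -> I + J) (b : 'I_n -> B) :
  (n <= m)%N -> (0 < n)%N -> cumulant_rec m chi b = bifree_cumulant chi b.
Proof.
rewrite /bifree_cumulant.
elim/ltn_ind: m n chi b => -[|m] IH [|n] chi b // nm _ /=.
congr (_ - _); apply: eq_bigr => pi /andP[piB piT]; apply: eq_bigr => V Vpi.
have /andP[V0 Vn] := BNC_card piB piT Vpi.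
have Vm : (#|V| <= m)%N by rewrite -ltnS (leq_trans Vn nm).
by rewrite (IH m (ltnSn _) _ _ _ Vm V0) (IH n nm _ _ _ Vn V0).
Qed.

Lemma bifree_cumulant_cast I J (m n : nat) (f : 'I_m -> 'I_n)
    (chi : 'I_n -> I + J) (b : 'I_n -> B) :
  m = n -> (forall i, f i = i :> nat) ->
  bifree_cumulant (chi \o f) (b \o f) = bifree_cumulant chi b.
Proof.
move=> mn; subst m => fE.
have -> : f = id by apply/funext => i; exact/val_inj/fE.
by [].
Qed.

Lemma bifree_moment_cumulant I J n (chi : 'I_n -> I + J) (b : 'I_n -> B) :
  (0 < n)%N ->
  psi (\prod_(k < n) b k) =
  \sum_(pi in BNC chi) \prod_(V in pi)
    @bifree_cumulant I J #|V| (chi \o enum_val) (b \o enum_val).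
Proof.
move=> n0; rewrite (bigD1 [set [set: 'I_n]]) ?BNC_setT//= big_set1.
rewrite (@bifree_cumulant_cast I J #|[set: 'I_n]| n); last 2 first.
- by rewrite cardsT card_ord.
- move=> i; have lti : (i < n)%N by rewrite -[X in (_ < X)%N]card_ord -cardsT.
  by rewrite (enum_val_nth (Ordinal lti)) enum_setT -enumT nth_enum_ord.
rewrite /bifree_cumulant; case: n chi b n0 => [//|n] chi b _ /=.
rewrite -addrA -[LHS]addr0; congr (_ + _); apply/esym/eqP.
rewrite addrC subr_eq0; apply/eqP.
apply: eq_bigr => pi /andP[piB piT]; apply: eq_bigr => V Vpi.
have /andP[V0 Vn] := BNC_card piB piT Vpi.
by rewrite (@cumulant_rec_fuel I J n #|V| _ _ Vn V0).
Qed.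

End cumulants.

Local Open Scope classical_set_scope.

Definition moment (R : realType) (B : pzRingType) (psi : B -> R[i]) (K : Type)
    (b : K -> B) (m : nat) (w : 'I_m -> K) : R[i] :=
  psi (\prod_(k < m) b (w k)).

(* The n-th family lives in its own space (B_ n, psi_ n). *)
Definition cvg_in_distribution (R : realType) (K : Type)
    (B_ : nat -> pzRingType) (psi_ : forall n, B_ n -> R[i])
    (b_ : forall n, K -> B_ n)
    (B : pzRingType) (psi : B -> R[i]) (b : K -> B) : Prop :=
  forall (m : nat) (w : 'I_m -> K),
    (fun n => moment (psi_ n) (b_ n) w : R[i]^o) @ \oo -->
    (moment psi b w : R[i]^o).

Record ncProbSpace (R : realType) := NcProbSpace {
  nc_algebra :> algType R[i];
  nc_state : {scalar nc_algebra};
  nc_state1 : nc_state 1 = 1 }.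

(* The library has no join of normed modules and algebras, so the norm (real
   valued) and its completeness are explicit fields. *)
Record cstarStructure (R : realType) (A : algType R[i]) := CstarStructure {
  cstar_norm : A -> R;
  cstar_star : A -> A;
  cstar_norm0_eq0 : forall x, cstar_norm x = 0 -> x = 0;
  cstar_normD : forall x y, cstar_norm (x + y) <= cstar_norm x + cstar_norm y;
  cstar_normZ : forall c x, cstar_norm (c *: x) = normc c * cstar_norm x;
  cstar_normM : forall x y, cstar_norm (x * y) <= cstar_norm x * cstar_norm y;
  cstar_complete : forall u : nat -> A,
    (forall e : R, 0 < e -> exists N, forall m n,
       (N <= m)%N -> (N <= n)%N -> cstar_norm (u m - u n) < e) ->
    exists l, (fun n => cstar_norm (u n - l)) @ \oo --> (0 : R);
  cstar_starK : involutive cstar_star;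
  cstar_starD : {morph cstar_star : x y / x + y};
  cstar_starZ : forall c x, cstar_star (c *: x) = conjc c *: cstar_star x;
  cstar_starM : forall x y, cstar_star (x * y) = cstar_star y * cstar_star x;
  cstar_identity : forall x, cstar_norm (cstar_star x * x) = cstar_norm x ^+ 2 }.

Record cstarProbSpace (R : realType) := CstarProbSpace {
  cstar_space :> ncProbSpace R;
  cstar_structure : cstarStructure cstar_space;
  cstar_state_ge0 : forall x : cstar_space,
    0 <= nc_state cstar_space (cstar_star cstar_structure x * x) }.

Definition star (R : realType) (A : cstarProbSpace R) : A -> A :=
  cstar_star (cstar_structure A).

Definition normalized_trace (R : realType) (d : nat) (M : 'M[R[i]]_d) : R[i] :=
  \tr M / d%:R.

Definition random_matrix (R : realType) dO (Om : measurableType dO) (d : nat)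
    (X : Om -> 'M[R[i]]_d) : Prop :=
  forall i j, measurable_fun setT (fun w => complex.Re (X w i j)) /\
              measurable_fun setT (fun w => complex.Im (X w i j)).

(* The sequence X also has a meaningless member at n = 0, which does not affect the
   limits. *)
Definition has_as_random_matrix_model (R : realType) (K : Type)
    (A : ncProbSpace R) (c : K -> A) : Prop :=
  exists (dO : measure_display) (Om : measurableType dO) (P : probability Om R)
         (X : forall n, K -> Om -> 'M[R[i]]_n),
    (forall n k, random_matrix (X n k)) /\
    {ae P, forall w : Om,
      cvg_in_distribution (fun n => @normalized_trace R n)
        (fun n k => X n k w : 'M[R[i]]_n) (nc_state A) c}.

(* The distribution of a enters through its joint moments only. *)
Definition has_compound_bifree_poisson (R : realType) (I J : Type)
    (B : ncProbSpace R) (z : I + J -> B)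
    (lambda : R) (A : ncProbSpace R) (a : I + J -> A) : Prop :=
  forall (n : nat) (chi : 'I_n -> I + J), (0 < n)%N ->
    bifree_cumulant (nc_state B) chi (z \o chi) =
    real_complex R lambda * moment (nc_state A) a chi.

Local Open Scope quotient_scope.

Section Linfm_functions.
Context d (Om : measurableType d) (R : realType) (P : probability Om R).

Definition all_moments (g : Om -> R) :=
  measurable_fun setT g /\ forall p : R, 1 <= p -> finite_norm P p%:E g.

Lemma finite_normE (p : R) (g : Om -> R) : 1 <= p ->
  finite_norm P p%:E g <-> (\int[P]_w (`|g w| `^ p)%:E < +oo)%E.
Proof.
move=> p1; have p0 : p != 0 by rewrite gt_eqF// (lt_le_trans ltr01).
rewrite /finite_norm; split=> [/(poweR_lty p)|h].
  by rewrite poweR_Lnorm.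
apply: (lty_poweRy p0); rewrite poweR_Lnorm//.
Qed.

Lemma all_moments_le (f g : Om -> R) : measurable_fun setT f ->
  (forall w, `|f w| <= `|g w|) -> all_moments g -> all_moments f.
Proof.
move=> mf fg [mg gfin]; split=> // p p1; apply: (finite_normE _ p1).2.
apply: le_lt_trans ((finite_normE g p1).1 (gfin _ p1)).
apply: ge0_le_integral => //.
- by apply/measurable_EFinP/(measurableT_comp (measurable_powR p))/measurableT_comp.
- by apply/measurable_EFinP/(measurableT_comp (measurable_powR p))/measurableT_comp.
- move=> w _; rewrite lee_fin ge0_ler_powR ?nnegrE// (le_trans ler01)//.
Qed.

Lemma all_momentsD (f g : Om -> R) : all_moments f -> all_moments g ->
  all_moments (f \+ g).
Proof.
move=> [mf ff] [mg fg]; split=> [|p p1]; first exact: measurable_funD.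
rewrite /finite_norm.
have := @eminkowski _ _ _ P f g p%:E mf mg; rewrite lee_fin => /(_ p1).
move=> /le_lt_trans; apply. rewrite lte_add_pinfty//; [exact: ff|exact: fg].
Qed.

Lemma all_momentsX2 (f : Om -> R) : all_moments f ->
  all_moments (fun w => f w ^+ 2).
Proof.
move=> [mf ff]; split=> [|p p1]; first exact: measurable_funX.
apply: (finite_normE _ p1).2.
have p2 : 1 <= 2 * p by rewrite (le_trans p1)// ler_peMl ?ler1n// (le_trans ler01).
have := (finite_normE f p2).1 (ff _ p2).
by under eq_integral do rewrite powRrM powR_mulrn// -normrX.
Qed.

Lemma all_moments_cst (c : R) : all_moments (cst c).
Proof.
split=> // p p1; apply: (finite_normE _ p1).2.
rewrite -[ltLHS]/(\int[P]_w cst (`|c| `^ p)%:E w)%E integral_cst//.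
rewrite [X in (_ * X)%E](_ : _ = 1%E) ?mule1 ?ltry//.
exact: probability_setT.
Qed.

(* The intersection of the spaces L^p, 1 <= p < oo, first as a ring of functions;
   Linfm below is its quotient by almost sure equality. *)
Definition Linfm_fun : {pred Om -> R[i]} := fun f =>
  `[< [/\ measurable_fun setT (fun w => complex.Re (f w)),
          measurable_fun setT (fun w => complex.Im (f w)) &
          forall p : R, 1 <= p -> finite_norm P p%:E (fun w => normc (f w))] >].

Lemma normc_sqrt (z : R[i]) : normc z = Num.sqrt (complex.Re z ^+ 2 + complex.Im z ^+ 2).
Proof. by case: z. Qed.

Lemma normc_ge0 (z : R[i]) : 0 <= normc z.
Proof. by rewrite normc_sqrt sqrtr_ge0. Qed.

Lemma measurable_normc (f : Om -> R[i]) :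
  measurable_fun setT (fun w => complex.Re (f w)) ->
  measurable_fun setT (fun w => complex.Im (f w)) ->
  measurable_fun setT (fun w => normc (f w)).
Proof.
move=> mr mi; rewrite (_ : (fun _ => _) =
    fun w => (complex.Re (f w) ^+ 2 + complex.Im (f w) ^+ 2) `^ 2^-1).
  apply: (measurableT_comp (measurable_powR _)).
  by apply: measurable_funD; exact: measurable_funX.
apply/funext => w; rewrite normc_sqrt powR12_sqrt//.
by rewrite addr_ge0// sqr_ge0.
Qed.

Lemma Linfm_funP (f : Om -> R[i]) :
  f \in Linfm_fun <-> [/\ measurable_fun setT (fun w => complex.Re (f w)),
    measurable_fun setT (fun w => complex.Im (f w)) &
    all_moments (fun w => normc (f w))].
Proof.
split=> [/asboolP[mr mi fin]|[mr mi [_ fin]]].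
  by split=> //; split=> //; exact: measurable_normc.
exact/asboolP.
Qed.

Lemma Linfm_fun_subring : subring_closed Linfm_fun.
Proof.
split.
- apply/Linfm_funP; split; [exact: measurable_cst|exact: measurable_cst|].
  exact: all_moments_cst.
- move=> f g /Linfm_funP[fr fi ff] /Linfm_funP[gr gi gf].
  have mr : measurable_fun setT (fun w => complex.Re ((f - g) w)).
    rewrite (_ : (fun _ => _) = (fun w => complex.Re (f w) - complex.Re (g w))).
      exact: measurable_funB.
    by apply/funext => w; rewrite !fctE; case: (f w) (g w) => ? ? [].
  have mi : measurable_fun setT (fun w => complex.Im ((f - g) w)).
    rewrite (_ : (fun _ => _) = (fun w => complex.Im (f w) - complex.Im (g w))).
      exact: measurable_funB.
    by apply/funext => w; rewrite !fctE; case: (f w) (g w) => ? ? [].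
  apply/Linfm_funP; split => //.
  apply: (all_moments_le (measurable_normc mr mi) _ (all_momentsD ff gf)) => w.
  rewrite !ger0_norm ?addr_ge0 ?normc_ge0//.
  by rewrite (le_trans (le_normcD _ _))// normcN.
- move=> f g /Linfm_funP[fr fi ff] /Linfm_funP[gr gi gf].
  have mr : measurable_fun setT (fun w => complex.Re ((f * g) w)).
    rewrite (_ : (fun _ => _) = (fun w => complex.Re (f w) * complex.Re (g w) - complex.Im (f w) * complex.Im (g w))).
      by apply: measurable_funB; exact: measurable_funM.
    by apply/funext => w; rewrite !fctE; case: (f w) (g w) => ? ? [].
  have mi : measurable_fun setT (fun w => complex.Im ((f * g) w)).
    rewrite (_ : (fun _ => _) = (fun w => complex.Re (f w) * complex.Im (g w) + complex.Im (f w) * complex.Re (g w))).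
      by apply: measurable_funD; exact: measurable_funM.
    by apply/funext => w; rewrite !fctE; case: (f w) (g w) => ? ? [].
  apply/Linfm_funP; split => //.
  apply: (all_moments_le (measurable_normc mr mi) _
    (all_momentsD (all_momentsX2 ff) (all_momentsX2 gf))) => w.
  rewrite fctE normcM ger0_norm ?mulr_ge0 ?normc_ge0// ger0_norm ?addr_ge0 ?sqr_ge0//.
  set a := normc _; set b := normc _.
  have a0 : 0 <= a by exact: normc_ge0.
  have b0 : 0 <= b by exact: normc_ge0.
  have [ab|/ltW ba] := leP a b.
    by rewrite (@le_trans _ _ (b ^+ 2))// ?lerDr ?sqr_ge0// expr2 ler_wpM2r.
  by rewrite (@le_trans _ _ (a ^+ 2))// ?lerDl ?sqr_ge0// expr2 ler_wpM2l.
Qed.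

HB.instance Definition _ :=
  GRing.isSubringClosed.Build (Om -> R[i]) Linfm_fun Linfm_fun_subring.

Record Linfm_fun_type := LinfmFun {
  Linfm_val :> Om -> R[i]; _ : Linfm_val \in Linfm_fun }.

HB.instance Definition _ := [isSub for Linfm_val].
HB.instance Definition _ := [Choice of Linfm_fun_type by <:].
HB.instance Definition _ := GRing.SubChoice_isSubComPzRing.Build
  (Om -> R[i]) Linfm_fun Linfm_fun_type (subringClosedP _).

Let one_neq0 : (1 : Linfm_fun_type) != 0.
Proof.
apply/eqP => /(congr1 (fun f => complex.Re (Linfm_val f point))) /= /eqP.
by rewrite oner_eq0.
Qed.

HB.instance Definition _ :=
  GRing.PzSemiRing_isNonZero.Build Linfm_fun_type one_neq0.

Definition Linfm_null : {pred Linfm_fun_type} := fun f =>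
  `[< {ae P, forall w, Linfm_val f w = 0} >].

Lemma Linfm_null_ideal : idealr_closed Linfm_null.
Proof.
split.
- by apply/asboolP/aeW.
- apply/asboolP => ae1.
  have : P setT = 0%E.
    have /negligibleP <- // : measurable [set: Om] by [].
    apply: negligibleS ae1 => w _ /= /eqP; by rewrite oner_eq0.
  rewrite (_ : P setT = 1%E); last exact: probability_setT.
  by move/eqP; rewrite onee_eq0.
- move=> h f g /asboolP f0 /asboolP g0; apply/asboolP.
  by apply: filterS2 f0 g0 => w fw gw; rewrite /= /GRing.add/= /GRing.mul/= fw gw mulr0 addr0.
Qed.

HB.instance Definition _ :=
  isIdealr.Build Linfm_fun_type Linfm_null Linfm_null_ideal.

Definition Linfm : Type := {ideal_quot Linfm_null}.
HB.instance Definition _ := GRing.ComNzRing.on Linfm.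

Definition Linfm_class (f : Linfm_fun_type) : Linfm := \pi_{ideal_quot Linfm_null} f.

Lemma Linfm_cst_subproof (c : R[i]) : cst c \in Linfm_fun.
Proof.
apply/Linfm_funP; split; [exact: measurable_cst|exact: measurable_cst|].
exact: all_moments_cst.
Qed.

Definition Linfm_cst (c : R[i]) : Linfm :=
  Linfm_class (LinfmFun (Linfm_cst_subproof c)).

Lemma Linfm_cst1 : Linfm_cst 1 = 1.
Proof.
rewrite /Linfm_cst /Linfm_class -[RHS]/(Quotient.one _) /Quotient.one; unlock.
by congr (\pi_ _); exact/val_inj.
Qed.

Lemma Linfm_cstM : {morph Linfm_cst : x y / x * y}.
Proof.
move=> x y; rewrite /Linfm_cst /Linfm_class -[RHS]/(Quotient.mul _ _).
rewrite -Quotient.pi_mul.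
by congr (\pi_ _); exact/val_inj.
Qed.

Lemma Linfm_cstD : {morph Linfm_cst : x y / x + y}.
Proof.
move=> x y; rewrite /Linfm_cst /Linfm_class -[RHS]/(Quotient.add _ _).
rewrite -Quotient.pi_add.
by congr (\pi_ _); exact/val_inj.
Qed.

Definition Linfm_scale (c : R[i]) (x : Linfm) : Linfm := Linfm_cst c * x.

Let scaleA a b v : Linfm_scale a (Linfm_scale b v) = Linfm_scale (a * b) v.
Proof. by rewrite /Linfm_scale mulrA Linfm_cstM. Qed.

Let scale1 : left_id 1 Linfm_scale.
Proof. by move=> v; rewrite /Linfm_scale Linfm_cst1 mul1r. Qed.

Let scaleDr : right_distributive Linfm_scale +%R.
Proof. by move=> a u v; rewrite /Linfm_scale mulrDr. Qed.

Let scaleDl v : {morph Linfm_scale^~ v : a b / a + b}.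
Proof. by move=> a b; rewrite /Linfm_scale Linfm_cstD mulrDl. Qed.

HB.instance Definition _ :=
  GRing.Zmodule_isLmodule.Build R[i] Linfm scaleA scale1 scaleDr scaleDl.

Lemma Linfm_scaleE (c : R[i]) (x : Linfm) : c *: x = Linfm_cst c * x.
Proof. by []. Qed.

Definition fun_expectation (f : Om -> R[i]) : R[i] :=
  Complex (fine 'E_P[fun w => complex.Re (f w)])
          (fine 'E_P[fun w => complex.Im (f w)]).

Definition Linfm_expectation (x : Linfm) : R[i] :=
  fun_expectation (Linfm_val (repr x)).

Lemma Linfm_expectationE (f : Linfm_fun_type) :
  Linfm_expectation (Linfm_class f) = fun_expectation f.
Proof.
rewrite /Linfm_expectation /fun_expectation /Linfm_class.
have /asboolP ae0 : repr (\pi_{ideal_quot Linfm_null} f) - f \in Linfm_null.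
  by rewrite Quotient.idealrBE reprK.
set g := repr _ in ae0 *.
have ae_fg : {ae P, forall w, Linfm_val g w = Linfm_val f w}.
  by apply: filterS ae0 => w; rewrite /= !fctE => /eqP; rewrite subr_eq0 => /eqP.
have /Linfm_funP[gr gi _] := valP g; have /Linfm_funP[fr fi _] := valP f.
rewrite unlock; congr (Complex (fine _) (fine _)); apply: ae_eq_integral => //.
- exact/measurable_EFinP.
- exact/measurable_EFinP.
- by apply: filterS ae_fg => w /= -> _.
- exact/measurable_EFinP.
- exact/measurable_EFinP.
- by apply: filterS ae_fg => w /= -> _.
Qed.

End Linfm_functions.

Section endomorphisms.
Context (K : pzRingType) (V : lmodType K).

Definition linop : Type := {linear V -> V}.
HB.instance Definition _ := Choice.on linop.

Definition linop0 : linop := \0.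
Definition linop_opp (A : linop) : linop := \- A.
Definition linop_add (A B : linop) : linop := A \+ B.
Definition linop1 : linop := idfun.
Definition linop_mul (A B : linop) : linop := A \o B.

Lemma linopP (A B : linop) : (A : V -> V) =1 B -> A = B.
Proof.
case: A B => [a [[a1] [a2]]] [b [[b1] [b2]]] /= /funext ab; subst b.
by rewrite (Prop_irrelevance a1 b1) (Prop_irrelevance a2 b2).
Qed.

Let addA : associative linop_add.
Proof. by move=> A B C; apply/linopP => v; exact: addrA. Qed.
Let addC : commutative linop_add.
Proof. by move=> A B; apply/linopP => v; exact: addrC. Qed.
Let add0 : left_id linop0 linop_add.
Proof. by move=> A; apply/linopP => v; exact: add0r. Qed.
Let addN : left_inverse linop0 linop_opp linop_add.
Proof. by move=> A; apply/linopP => v; exact: addNr. Qed.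
HB.instance Definition _ := GRing.isZmodule.Build linop addA addC add0 addN.

Let mulA : associative linop_mul.
Proof. by move=> A B C; apply/linopP. Qed.
Let mul1 : left_id linop1 linop_mul.
Proof. by move=> A; apply/linopP. Qed.
Let mulr1 : right_id linop1 linop_mul.
Proof. by move=> A; apply/linopP. Qed.
Let mulDl : left_distributive linop_mul linop_add.
Proof. by move=> A B C; apply/linopP. Qed.
Let mulDr : right_distributive linop_mul linop_add.
Proof. by move=> A B C; apply/linopP => v; exact: linearD. Qed.
HB.instance Definition _ :=
  GRing.Zmodule_isPzRing.Build linop mulA mul1 mulr1 mulDl mulDr.

End endomorphisms.

Section random_two_faced.
Context dO (Om : measurableType dO) (R : realType) (P : probability Om R).
Context (d : nat).

(* An alias of the matrix type, whose canonical scalars are Linfm P rather than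
   the complex numbers. *)
Definition Xmx : Type := 'M[Linfm P]_d.
HB.instance Definition _ := GRing.Zmodule.on Xmx.

Definition Xmx_scale (c : R[i]) (eta : Xmx) : Xmx :=
  \matrix_(i, j) (c *: eta i j).

Let scaleA a b v : Xmx_scale a (Xmx_scale b v) = Xmx_scale (a * b) v.
Proof. by apply/matrixP => i j; rewrite !mxE scalerA. Qed.
Let scale1 : left_id 1 Xmx_scale.
Proof. by move=> v; apply/matrixP => i j; rewrite !mxE scale1r. Qed.
Let scaleDr : right_distributive Xmx_scale +%R.
Proof. by move=> a u v; apply/matrixP => i j; rewrite !mxE scalerDr. Qed.
Let scaleDl v : {morph Xmx_scale^~ v : a b / a + b}.
Proof. by move=> a b; apply/matrixP => i j; rewrite !mxE scalerDl. Qed.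
HB.instance Definition _ :=
  GRing.Zmodule_isLmodule.Build R[i] Xmx scaleA scale1 scaleDr scaleDl.

Definition left_fun (T : 'M[Linfm P]_d) (eta : Xmx) : Xmx :=
  \matrix_(i, j) \sum_(k < d) T i k * eta k j.

Definition right_fun (T : 'M[Linfm P]_d) (eta : Xmx) : Xmx :=
  \matrix_(i, j) \sum_(k < d) T k j * eta i k.

Let left_linear T : linear (left_fun T).
Proof.
move=> c u v; apply/matrixP => i j; rewrite !mxE scaler_sumr -big_split /=.
by apply: eq_bigr => k _; rewrite !mxE !Linfm_scaleE mulrDr mulrCA.
Qed.
HB.instance Definition _ T :=
  GRing.isLinear.Build R[i] Xmx Xmx *:%R (left_fun T) (left_linear T).

Let right_linear T : linear (right_fun T).
Proof.
move=> c u v; apply/matrixP => i j; rewrite !mxE scaler_sumr -big_split /=.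
by apply: eq_bigr => k _; rewrite !mxE !Linfm_scaleE mulrDr mulrCA.
Qed.
HB.instance Definition _ T :=
  GRing.isLinear.Build R[i] Xmx Xmx *:%R (right_fun T) (right_linear T).

Definition left_matrix (T : 'M[Linfm P]_d) : linop Xmx := left_fun T.
Definition right_matrix (T : 'M[Linfm P]_d) : linop Xmx := right_fun T.

Definition E_op (A : linop Xmx) : 'M[R[i]]_d :=
  \matrix_(i, j) Linfm_expectation (A (1%:M : 'M[Linfm P]_d) i j).

Definition Phi_op (A : linop Xmx) : R[i] := normalized_trace (E_op A).

Definition two_faced_matrices (I J : Type) (Z : I + J -> linop Xmx) : Prop :=
  (forall i, exists T, Z (inl i) = left_matrix T) /\
  (forall j, exists T, Z (inr j) = right_matrix T).

End random_two_faced.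

(* Main.v *)
Require Import Defs.
From HB Require Import structures.
From mathcomp Require Import all_boot all_order all_algebra.
From mathcomp Require Import all_classical all_reals all_analysis.
From mathcomp Require Import complex.
Import Order.TTheory GRing.Theory Num.Theory.
Import numFieldNormedType.Exports.
Set Implicit Arguments.
Unset Strict Implicit.
Unset Printing Implicit Defensive.
Local Open Scope ring_scope.

Local Notation is_left := Defs.is_left.

(** The limit moments of Z(n) are attained exactly, for all words of length at
    most n, by matrices whose entries are constants.

    With T_k the matrix behind Z_k, the product of Z_k along a word chi acts on the
    identity matrix by multiplying the left T_k in the order written and the right
    ones in the opposite order; Phi is therefore the normalized trace of the T_k
    along chi o s_chi (constant_family_prod). Likewise BNC(chi) is the image of
    NC(n) under s_chi. Because the two faces of a commute, a block of the
    compound Poisson moment-cumulant formula contributes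
    lambda phi(left letters, then right letters), which depends only on the order
    inside each face. So the moment of the limit at chi is G(chi o s_chi), where
    G(u) sums over NC(n) the products over blocks of lambda times phi of the
    block word with its right letters reversed back (bnc_sumE). Matrices T_k
    with normalized traces tr(T_u) = G(u) are all that is needed.

    Such a G must be invariant under rotation of u, and it is. The state phi is
    tracial on words in a, as a limit of normalized traces (model_trace); with the
    commutation of the faces this makes the contribution of a block cyclic
    (trace_chi_order_cyclic), and rotation permutes the non-crossing partitions
    (nc_fun_cyclic).

    Conversely cyclicity is the only constraint: the traces of all words up
    to a given length can be prescribed at will (cyclic_fun_realization). For each length m a
    weighted cyclic shift with m phases has trace zero on words shorter than m and
    arbitrary cyclic values on words of length m, so direct sums of these shifts
    adjust the traces length by length. Multiplying the prescribed values by the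
    dimension passes to normalized traces (normalized_trace_realization).

    A space carrying the limit distribution is given by operators on functions
    of words (word_state_prod), and its cumulants are read off from the moments
    by the uniqueness in the moment-cumulant recursion (bifree_cumulant_eq). *)

Definition cyclic_fun (T S : Type) (G : seq T -> S) : Prop :=
  forall u, G (rot 1 u) = G u.

(** * Matrices with prescribed traces of short words *)
Section trace_prescription.
Context (C : numClosedFieldType) (K : finType).

Definition word_trace d (X : K -> 'M[C]_d) (w : seq K) : C :=
  \tr (\prod_(x <- w) X x).

Lemma word_trace_cyclic d (X : K -> 'M[C]_d) : cyclic_fun (word_trace X).
Proof.
case=> [|x u] //; rewrite /word_trace rot1_cons -cats1 big_cat /= big_seq1.
by rewrite big_cons -[in RHS]mulmxE -mxtrace_mulC.
Qed.

(** Traces of words add up over direct sums, which allows traces to be adjusted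
    one word length at a time. *)
Lemma word_trace_block d1 d2 (X : K -> 'M[C]_d1) (Y : K -> 'M[C]_d2) w :
  word_trace (fun x => block_mx (X x) 0 0 (Y x)) w =
  word_trace X w + word_trace Y w.
Proof.
rewrite /word_trace -(mxtrace_block _ 0 0); congr (\tr _).
elim: w => [|x w IH]; first by rewrite !big_nil -scalar_mx_block.
rewrite !big_cons IH -mulmxE mulmx_block.
by rewrite !(mul0mx, mulmx0, addr0, add0r).
Qed.

Lemma word_trace_zero d w : (0 < size w)%N ->
  word_trace (fun=> 0 : 'M[C]_d) w = 0.
Proof. by case: w => //= x w _; rewrite /word_trace big_cons mul0r mxtrace0. Qed.

(** Words act on the states of a deterministic automaton whose transition
    sigma is the same for all letters; only the weights depend on the letter. A
    word then contributes to the trace exactly at the states to which it returns. *)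
Section automaton.
Context (S : finType) (sigma : S -> S) (wt : K -> S -> C).

Definition transition_mx (x : K) : 'M[C]_#|S| :=
  \matrix_(i, j) (wt x (enum_val i) * (enum_val j == sigma (enum_val i))%:R).

Fixpoint path_weight (w : seq K) (s : S) : C :=
  if w is x :: w' then wt x s * path_weight w' (sigma s) else 1.

Lemma transition_prodE w i j :
  (\prod_(x <- w) transition_mx x) i j =
  path_weight w (enum_val i) *
  (enum_val j == iter (size w) sigma (enum_val i))%:R.
Proof.
elim: w i j => [|x w IH] i j.
  rewrite big_nil mul1r /= (inj_eq enum_val_inj) -[1]/(1%:M : 'M[C]_#|S|).
  by rewrite mxE eq_sym.
rewrite big_cons -mulmxE mxE (bigD1 (enum_rank (sigma (enum_val i)))) //=.
rewrite IH mxE enum_rankK eqxx mulr1 mulrA -iterSr big1 ?addr0// => k kn.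
rewrite mxE; case: eqVneq => [ek|]; last by rewrite mulr0 mul0r.
by move: kn; rewrite -ek enum_valK eqxx.
Qed.

Lemma word_trace_transition w :
  word_trace transition_mx w =
  \sum_(s | iter (size w) sigma s == s) path_weight w s.
Proof.
rewrite [RHS]big_mkcond (big_enum_val (A := predT)) /=.
apply: eq_bigr => i _; rewrite transition_prodE (eq_sym (enum_val i)).
by case: eqP => _; rewrite ?mulr1 ?mulr0.
Qed.
End automaton.

(** A state (v, i) is a word v of length m = n.+1 together with a phase
    i. Reading a letter is allowed only if it is the first letter of v, and then
    rotates v and advances the phase. The phase prevents a periodic v from closing
    up before m letters are read, so words shorter than m have trace zero. Each of
    the m steps carries an m-th root of c v, the same at every step because c is
    cyclic; the full turn along v thus has weight c v. *)
Section cyclic_words.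
Context (n : nat) (c : seq K -> C) (c_cyclic : cyclic_fun c).
Local Notation S := (n.+1.-tuple K * 'I_n.+1)%type.

Let sigma (s : S) : S := ([tuple of rot 1 s.1], ordS s.2).
Let wt (x : K) (s : S) : C := (thead s.1 == x)%:R * n.+1.-root (c s.1).

Let path_weightE w s : (size w <= n.+1)%N ->
  path_weight sigma wt w s =
  (take (size w) s.1 == w)%:R * n.+1.-root (c s.1) ^+ size w.
Proof.
elim: w s => [|x w IH] s; first by rewrite take0 eqxx mulr1.
rewrite /= ltnS => sw; rewrite {}IH; last exact: leqW.
rewrite /= c_cyclic; case: s => /= v i.
case/tupleP: v => y t; rewrite /wt /= theadE /= rot1_cons -cats1.
rewrite takel_cat ?size_tuple// eqseq_cons -mulnb natrM.
by rewrite mulrACA exprS.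
Qed.

Let iter_sigma k s : (iter k sigma s).2 = ((s.2 + k) %% n.+1)%N :> nat.
Proof.
elim: k => [|k IH] /=; first by rewrite addn0 modn_small.
by rewrite IH -addn1 modnDml -addnA addn1 addnS.
Qed.

Lemma cyclic_words_realization :
  exists X : K -> 'M[C]_#|{: n.+1.-tuple K * 'I_n.+1}|,
    forall w, (0 < size w <= n.+1)%N ->
      word_trace X w = if size w == n.+1 then n.+1%:R * c w else 0.
Proof.
exists (transition_mx sigma wt) => w /andP[w0 wn]; rewrite word_trace_transition.
case: ltngtP wn => // [wn _|wn _].
  rewrite big_pred0// => s; apply/negbTE; apply: contraTneq wn => /(congr1 snd).
  move=> /(congr1 (@nat_of_ord _)); rewrite iter_sigma => e.
  rewrite -leqNgt; apply: dvdn_leq => //.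
  have : (s.2 + size w = s.2 + 0 %[mod n.+1])%N by rewrite e addn0 modn_small.
  by move/eqP; rewrite eqn_modDl mod0n.
have rot_all (s : S) : iter (size w) sigma s = s.
  have aux k : (k <= n.+1)%N -> (iter k sigma s).1 = rot k s.1 :> seq K.
    elim: k => [|k IH] kn; first by rewrite rot0.
    by rewrite /= IH 1?ltnW// -[in RHS]add1n rotD ?size_tuple.
  have e1 : (iter (size w) sigma s).1 = s.1.
    by apply/val_inj; rewrite /= aux ?wn// -[X in rot X](size_tuple s.1) rot_size.
  have e2 : (iter (size w) sigma s).2 = s.2.
    by apply/val_inj; rewrite /= iter_sigma wn modnDr modn_small.
  by rewrite [LHS]surjective_pairing e1 e2 -surjective_pairing.
under eq_bigl do rewrite rot_all eqxx.
have wP : size w == n.+1 by rewrite wn.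
(* A word of length m can be read only from the states (w, i), i < m. *)
transitivity (\sum_(s : S | s.1 == Tuple wP) c w).
  rewrite [RHS]big_mkcond; apply: eq_bigr => s _.
  rewrite path_weightE ?wn// take_oversize ?size_tuple//.
  rewrite -[X in if X then _ else _](inj_eq val_inj) /=.
  case: eqP => [->|_]; last by rewrite mul0r.
  by rewrite mul1r rootCK.
rewrite (eq_bigl (fun s => pred1 (Tuple wP) s.1 && predT s.2)); last first.
  by move=> s; rewrite /= andbT.
rewrite -(pair_big (pred1 (Tuple wP)) predT (fun _ _ => c w)) /=.
rewrite big_pred1_eq.
by rewrite sumr_const card_ord mulr_natl.
Qed.
End cyclic_words.

Fixpoint realization_dim (n : nat) : nat :=
  if n is m.+1 then (realization_dim m + #|{: m.+1.-tuple K * 'I_m.+1}|)%N else 0.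

(** Induction on the word length: the summand added for length n.+1 vanishes on
    shorter words and corrects the traces at length n.+1. The correction is itself
    cyclic, being a difference of cyclic functions; the divisor n.+1 compensates for
    the n.+1 phases at which a word of that length can be read. *)
Lemma cyclic_fun_realization n (G : seq K -> C) : cyclic_fun G ->
  exists X : K -> 'M[C]_(realization_dim n),
    forall w, (0 < size w <= n)%N -> word_trace X w = G w.
Proof.
move=> Gcyc; elim: n => [|n [X XE]].
  by exists (fun=> 0) => w; rewrite leqn0 lt0n andNb.
pose c w := (G w - word_trace X w) / n.+1%:R.
have cc : cyclic_fun c by move=> w; rewrite /c Gcyc word_trace_cyclic.
have [Y YE] := @cyclic_words_realization n c cc.
exists (fun x => block_mx (X x) 0 0 (Y x)) => w /andP[w0 wn].
rewrite word_trace_block YE ?w0//; case: eqVneq => [wn1|wn1].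
  by rewrite /c mulrCA divff ?pnatr_eq0// mulr1 addrC subrK.
by rewrite addr0 XE// w0 -ltnS ltn_neqAle wn1.
Qed.
End trace_prescription.

Lemma realization_dimS (K : finType) n :
  (realization_dim K n <= realization_dim K n.+1)%N.
Proof. exact: leq_addr. Qed.

(** The empty word forces G [::] = 1, the value of the normalized trace at the
    identity. The zero block of size n.+1 costs nothing and makes the total
    dimension positive and, together with realization_dimS, strictly increasing
    in n. *)
Lemma normalized_trace_realization (R : realType) (K : finType)
    (G : seq K -> R[i]) :
  cyclic_fun G -> G [::] = 1 -> forall n,
  exists X : K -> 'M[R[i]]_(n.+1 + realization_dim K n),
    forall w, (size w <= n)%N -> normalized_trace (\prod_(k <- w) X k) = G w.
Proof.
move=> Gc G1 n; set d := (n.+1 + _)%N.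
have [|X XE] := @cyclic_fun_realization R[i] K n (fun w => d%:R * G w).
  by move=> u; rewrite Gc.
exists (fun k => block_mx 0 0 0 (X k)) => w wn; rewrite /normalized_trace.
case: (posnP (size w)) => [/size0nil ->|w0].
  by rewrite big_nil mxtrace1 divff ?pnatr_eq0.
rewrite -[\tr _]/(word_trace _ w) word_trace_block word_trace_zero//.
by rewrite add0r XE ?w0// mulrC mulKf// pnatr_eq0.
Qed.

(** * Sums over non-crossing partitions and rotations *)

Section nc_sums.
Context (C : comPzRingType) (K : Type) (g : seq K -> C).

Definition nc_sum n (chi : 'I_n -> K) : C :=
  \sum_(pi in NC n) \prod_(V in pi) g [seq chi k | k <- enum V].

(** The version on words makes functions on 'I_m and 'I_n comparable when m and
    n are only provably equal, as are the sizes of a word and its rotation. *)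
Definition nc_fun (u : seq K) : C := nc_sum (tnth (in_tuple u)).

Lemma nc_funE n (chi : 'I_n -> K) : nc_fun (map chi (enum 'I_n)) = nc_sum chi.
Proof.
have cast m (chi' : 'I_m -> K) : m = n ->
    (forall (i : 'I_m) (j : 'I_n), i = j :> nat -> chi' i = chi j) -> nc_sum chi' = nc_sum chi.
  move=> mn; subst m => e; congr nc_sum; apply/funext => i; exact: e.
apply: cast => [|i j ij]; first by rewrite size_map size_enum_ord.
rewrite (tnth_nth (chi j)) (nth_map j) ?ij ?size_enum_ord//.
by congr chi; apply/val_inj; rewrite /= nth_enum_ord.
Qed.

Lemma NC0E : NC 0 = [set finset.set0].
Proof.
apply/setP => pi; rewrite !inE; apply/andP/eqP => [[/and3P[_ _ n0] _]|->].
  apply/setP => V; rewrite inE; apply: contraNF n0 => Vpi.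
  by rewrite (_ : finset.set0 = V)//; apply/setP; case.
split.
  rewrite /finset.partition /finset.cover finset.big_set0 inE andbT; apply/andP.
  split; first by apply/eqP/setP; case.
  by apply/finset.trivIsetP => V W; rewrite inE.
by apply/'forall_implyP => V; rewrite inE.
Qed.

Lemma nc_fun_nil : nc_fun [::] = 1.
Proof. by rewrite /nc_fun /nc_sum NC0E big_set1 big_set0. Qed.

End nc_sums.

Section rotation.
Context (n : nat).
Local Notation rho := (@ordS n.+1).
Implicit Types (V W : {set 'I_n.+1}) (pi : {set {set 'I_n.+1}}).

Definition rotate_blocks pi : {set {set 'I_n.+1}} := [set rho @: V | V : {set 'I_n.+1} in pi].

Lemma ordS_max : rho ord_max = ord0.
Proof. by apply/val_inj; rewrite /= modnn. Qed.

Lemma ordS_pred (i : 'I_n.+1) : (0 < i)%N ->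
  exists2 j : 'I_n.+1, i = rho j & j.+1 = i :> nat.
Proof.
move=> i0; have lt : (i.-1 < n.+1)%N by rewrite (leq_ltn_trans (leq_pred _)).
exists (Ordinal lt); last by rewrite /= prednK.
by apply/val_inj; rewrite /= prednK// modn_small.
Qed.

(** Being non-crossing is a property of points on a circle. If a crossing of the
    rotated partition avoids 0, it pulls back to one of pi with each point shifted
    down; if it starts at 0, that point becomes the last one, and the crossing
    persists with the roles of V and W exchanged. *)
Lemma rotate_NC pi : pi \in NC n.+1 -> rotate_blocks pi \in NC n.+1.
Proof.
rewrite !inE => /andP[ppi /'forall_implyP nc]; apply/andP; split.
  suff -> : [set: 'I_n.+1] = rho @: [set: 'I_n.+1].
    by rewrite imset_partition //; exact: ordS_inj.
  apply/esym/eqP; rewrite eqEcard finset.subsetT card_imset ?leqnn//.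
  exact: ordS_inj.
(* Non-crossing, free of the boolean encoding. *)
have {}nc V W (a b c d : 'I_n.+1) : V \in pi -> W \in pi -> a \in V -> b \in W ->
    c \in V -> d \in W -> (a < b)%N -> (b < c)%N -> (c < d)%N -> V = W.
  move=> Vpi Wpi aV bW cV dW ab bc cd; apply/eqP.
  have /'forall_implyP/(_ W Wpi)/'forall_implyP/(_ a aV) := nc V Vpi.
  move=> /'forall_implyP/(_ b bW)/'forall_implyP/(_ c cV).
  by move=> /'forall_implyP/(_ d dW); rewrite ab bc cd.
apply/'forall_implyP => V' /imsetP[V Vpi ->{V'}].
apply/'forall_implyP => W' /imsetP[W Wpi ->{W'}].
apply/'forall_implyP => a aV; apply/'forall_implyP => b bW.
apply/'forall_implyP => c cV; apply/'forall_implyP => d dW.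
apply/implyP => /and3P[ab bc cd]; apply/eqP; congr (rho @: _).
have pull (i : 'I_n.+1) (U : {set 'I_n.+1}) (j : 'I_n.+1) : (j < i)%N -> i \in rho @: U ->
    exists2 k : 'I_n.+1, k \in U & k.+1 = i :> nat.
  move=> ji; have [k -> ki] := ordS_pred (leq_ltn_trans (leq0n j) ji).
  by rewrite mem_imset; [exists k|exact: ordS_inj].
have [b' bW' b'E] := pull _ _ _ ab bW.
have [c' cV' c'E] := pull _ _ _ bc cV.
have [d' dW' d'E] := pull _ _ _ cd dW.
move: ab bc cd; rewrite -b'E -c'E -d'E !ltnS => ab bc cd.
have [a0|a0] := posnP a.
  have amax : ord_max \in V.
    move: aV; rewrite (_ : a = rho ord_max) ?ordS_max; last exact/val_inj.
    by rewrite -ordS_max mem_imset//; exact: ordS_inj.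
  rewrite (nc W V b' c' d' ord_max) => //=.
  by rewrite -ltnS d'E.
have [a' aE a'E] := ordS_pred a0.
move: aV; rewrite aE mem_imset; last exact: ordS_inj.
by move=> aV; rewrite (nc V W a' b' c' d') // a'E.
Qed.

Lemma rotate_blocks_inj : injective rotate_blocks.
Proof. by apply: imset_inj; apply: imset_inj; exact: ordS_inj. Qed.

Lemma rotate_blocks_NC : rotate_blocks @: NC n.+1 = NC n.+1.
Proof.
apply/eqP; rewrite eqEcard card_imset ?leqnn ?andbT; last exact: rotate_blocks_inj.
by apply/fintype.subsetP => _ /imsetP[pi piN ->]; exact: rotate_NC.
Qed.

Lemma sorted_enum_ord m (A : {set 'I_m}) : sorted (relpre val ltn) (enum A).
Proof.
rewrite /enum_mem sorted_filter//; first by move=> y x z /= /ltn_trans; apply.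
by rewrite -sorted_map -enumT val_enum_ord iota_ltn_sorted.
Qed.

Lemma enum_ord_eq m (A : {set 'I_m}) s :
  sorted (relpre val ltn) s -> s =i A -> enum A = s.
Proof.
move=> ss sA; apply: (irr_sorted_eq _ _ (sorted_enum_ord A) ss).
- by move=> y x z /= /ltn_trans; apply.
- by move=> x /=; rewrite ltnn.
- by move=> x; rewrite mem_enum sA.
Qed.

Lemma enum_rotate_no_wrap V : ord_max \notin V ->
  enum (rho @: V) = map rho (enum V).
Proof.
move=> Vmax; apply: enum_ord_eq => [|i].
  apply: (homo_sorted_in (P := mem V) _ _ (sorted_enum_ord V)).
    move=> i j iV jV /= ij; rewrite !modn_small// ltnS ltn_neqAle -ltnS ltn_ord andbT.
      by apply: contraNneq Vmax => jn; rewrite (_ : ord_max = j)//; exact/val_inj.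
    by apply: contraNneq Vmax => jn; rewrite (_ : ord_max = i)//; exact/val_inj.
  by apply/allP => i; rewrite mem_enum.
apply/mapP/imsetP => -[j jV ->]; exists j => //; first by rewrite mem_enum in jV.
by rewrite mem_enum.
Qed.

(** The blocks are read increasingly, so the rotated block is read in rotated
    order exactly when it contains the wrap-around point. *)
Lemma enum_rotate V :
  enum (rho @: V) = map rho (enum V) \/ enum (rho @: V) = rotr 1 (map rho (enum V)).
Proof.
have [Vmax|Vmax] := boolP (ord_max \in V); last by left; exact: enum_rotate_no_wrap.
right; set U := V :\ ord_max.
have Umax : ord_max \notin U by rewrite !inE eqxx.
(* The wrap-around point is the last of V and becomes the first of the image. *)
have -> : enum V = rcons (enum U) ord_max.
  apply: enum_ord_eq => [|i].
    rewrite sorted_pairwise; last by move=> y x z /= /ltn_trans; apply.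
    rewrite pairwise_rcons -sorted_pairwise; last by move=> y x z /= /ltn_trans; apply.
    rewrite sorted_enum_ord andbT; apply/allP => i; rewrite mem_enum !inE => /andP[im _].
    by rewrite /= ltn_neqAle im -ltnS ltn_ord.
  by rewrite mem_rcons inE mem_enum !inE; case: eqVneq => [->|].
rewrite map_rcons rotr1_rcons -enum_rotate_no_wrap// ordS_max.
apply: enum_ord_eq => [|i].
  rewrite /= path_sortedE; last by move=> y x z /= /ltn_trans; apply.
  rewrite sorted_enum_ord andbT; apply/allP => i; rewrite mem_enum => /imsetP[j jU ->] /=.
  rewrite modn_small// ltnS ltn_neqAle -ltnS ltn_ord andbT.
  by apply: contraNneq Umax => jn; rewrite (_ : ord_max = j)//; exact/val_inj.
by rewrite inE mem_enum -(finset.setD1K Vmax) imsetU1 ordS_max !inE.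
Qed.

Lemma map_ordS_enum : map rho (enum 'I_n.+1) = rot 1 (enum 'I_n.+1).
Proof.
apply: (inj_map val_inj); rewrite map_rot val_enum_ord -map_comp.
rewrite (@eq_map _ _ _ ((fun k => k.+1 %% n.+1)%N \o val)) // map_comp val_enum_ord.
rewrite [in RHS]/= rot1_cons -[in iota 0 _]addn1 iotaD add0n map_cat /= modnn cats1.
congr rcons; rewrite (iotaDl 1 0); apply/eq_in_map => k.
by rewrite mem_iota => kn; rewrite modn_small.
Qed.

End rotation.

(** Rotation permutes the non-crossing partitions and changes the word read along
    each block by at most a rotation, which g ignores. *)
Lemma nc_fun_cyclic (C : comPzRingType) (K : Type) (g : seq K -> C) :
  cyclic_fun g -> cyclic_fun (nc_fun g).
Proof.
move=> gc u; case un : (size u) => [|n]; first by rewrite (size0nil un).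
have [chi ->] : exists chi : 'I_n.+1 -> K, u = map chi (enum 'I_n.+1).
  rewrite -un; exists (tnth (in_tuple u)).
  by rewrite -[LHS](map_tnth_enum (in_tuple u)).
rewrite -map_rot -map_ordS_enum -map_comp !nc_funE /nc_sum.
rewrite -[in RHS]rotate_blocks_NC big_imset; last by apply: in2W; exact: rotate_blocks_inj.
apply: eq_bigr => pi _; rewrite big_imset; last first.
  by apply: in2W; apply: imset_inj; exact: ordS_inj.
apply: eq_bigr => V _; rewrite (map_comp chi).
have [->//|->] := enum_rotate V.
by rewrite map_rotr -[RHS]gc rotrK.
Qed.

(** * A non-commutative probability space with given moments *)

Section words_as_operators.
Context (C : comNzRingType) (K : Type).

(** An alias of the ring of linear endomorphisms of the space of all functions of
    words, to carry the structure of an algebra. Any function M of words with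
    M [::] = 1 becomes a moment functional on it: each letter acts by appending
    itself to the argument, and a product applied to M is evaluated at the empty
    word. *)
Definition endomorphism_alg : Type := linop (seq K -> C^o).
HB.instance Definition _ := GRing.PzRing.on endomorphism_alg.

Let endomorphism_alg1_neq0 : (1 : endomorphism_alg) != 0.
Proof.
apply/eqP => /(congr1 (fun A : endomorphism_alg => (A : {linear _ -> _}) (cst 1) [::])).
by move=> /eqP; rewrite /= oner_eq0.
Qed.
HB.instance Definition _ :=
  GRing.PzSemiRing_isNonZero.Build endomorphism_alg endomorphism_alg1_neq0.

Definition endomorphism_alg_scale (c : C) (A : endomorphism_alg) : endomorphism_alg :=
  (c \*: (A : {linear _ -> _}) : {linear (seq K -> C^o) -> (seq K -> C^o)}).

Let scaleA a b v :
  endomorphism_alg_scale a (endomorphism_alg_scale b v) =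
  endomorphism_alg_scale (a * b) v.
Proof. by apply/linopP => f; exact: scalerA. Qed.
Let scale1 : left_id 1 endomorphism_alg_scale.
Proof. by move=> v; apply/linopP => f; exact: scale1r. Qed.
Let scaleDr : right_distributive endomorphism_alg_scale +%R.
Proof. by move=> a u v; apply/linopP => f; exact: scalerDr. Qed.
Let scaleDl v : {morph endomorphism_alg_scale^~ v : a b / a + b}.
Proof. by move=> a b; apply/linopP => f; exact: scalerDl. Qed.
HB.instance Definition _ :=
  GRing.Zmodule_isLmodule.Build C endomorphism_alg scaleA scale1 scaleDr scaleDl.

Let scaleAl (a : C) (u v : endomorphism_alg) : a *: (u * v) = (a *: u) * v.
Proof. exact/linopP. Qed.
HB.instance Definition _ := GRing.Lmodule_isLalgebra.Build C endomorphism_alg scaleAl.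

Let scaleAr (a : C) (u v : endomorphism_alg) : a *: (u * v) = u * (a *: v).
Proof. by apply/linopP => f; apply/esym; exact: linearZ. Qed.
HB.instance Definition _ := GRing.Lalgebra_isAlgebra.Build C endomorphism_alg scaleAr.

Definition append_fun (k : K) (f : seq K -> C^o) : seq K -> C^o := fun w => f (rcons w k).

Let append_linear k : linear (append_fun k).
Proof. by move=> c f g; apply/funext. Qed.
HB.instance Definition _ k :=
  GRing.isLinear.Build C (seq K -> C^o) (seq K -> C^o) *:%R (append_fun k) (append_linear k).

Definition append_letter (k : K) : endomorphism_alg := (append_fun k : {linear _ -> _}).

Definition word_state (M : seq K -> C^o) (A : endomorphism_alg) : C :=
  (A : {linear _ -> _}) M [::].

Let word_state_linear M : scalar (word_state M).
Proof. by []. Qed.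
HB.instance Definition _ M :=
  GRing.isLinear.Build C endomorphism_alg C *%R (word_state M) (word_state_linear M).

Lemma word_state_prod M w : word_state M (\prod_(k <- w) append_letter k) = M w.
Proof.
suff E u : ((\prod_(k <- w) append_letter k : endomorphism_alg) : {linear _ -> _}) M u =
    M (u ++ w).
  exact: E.
elim: w u => [|k w IH] u; first by rewrite big_nil cats0.
by rewrite big_cons -cat_rcons; exact: IH.
Qed.

End words_as_operators.

(** * Left and right matrices with constant entries *)

Lemma prod_ord_word (K : Type) (B : pzRingType) (b : K -> B) m (w : 'I_m -> K) :
  \prod_(k < m) b (w k) = \prod_(x <- map w (enum 'I_m)) b x.
Proof. by rewrite big_map enumT; congr (bigop _ _); rewrite unlock. Qed.

(** This is the order in which the variables of a word meet on one side: products
    L(T) act from the left in the order written, products R(T) from the right,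
    so that the first one written ends up last. *)
Definition chi_order (I J : Type) (u : seq (I + J)) : seq (I + J) :=
  [seq k <- u | is_left k] ++ rev [seq k <- u | ~~ is_left k].

Section constant_entries.
Context dO (Om : measurableType dO) (R : realType) (P : probability Om R).

Let Linfm_cst0 : Linfm_cst P 0 = 0.
Proof. by apply: (@addrI _ (Linfm_cst P 0)); rewrite -Linfm_cstD !addr0. Qed.

Let Linfm_cstB : {morph Linfm_cst P : x y / x - y}.
Proof.
move=> x y; rewrite Linfm_cstD; congr (_ + _); apply: (@addrI _ (Linfm_cst P y)).
by rewrite -Linfm_cstD !subrr Linfm_cst0.
Qed.

HB.instance Definition _ := GRing.isZmodMorphism.Build _ _ (Linfm_cst P) Linfm_cstB.
HB.instance Definition _ := GRing.isMonoidMorphism.Build _ _ (Linfm_cst P)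
  (Linfm_cst1 P, @Linfm_cstM _ _ _ P).

Lemma Linfm_expectation_cst c : Linfm_expectation (Linfm_cst P c) = c.
Proof.
rewrite Linfm_expectationE /fun_expectation /= !expectation_cst /=.
by case: c.
Qed.

Definition cst_mx d (X : 'M[R[i]]_d) : 'M[Linfm P]_d := map_mx (Linfm_cst P) X.

Lemma left_matrix_cst d (X Y : 'M[R[i]]_d) :
  left_fun (cst_mx X) (cst_mx Y) = cst_mx (X *m Y).
Proof.
apply/matrixP => i j; rewrite !mxE rmorph_sum; apply: eq_bigr => k _.
by rewrite !mxE rmorphM.
Qed.

Lemma right_matrix_cst d (X Y : 'M[R[i]]_d) :
  right_fun (cst_mx X) (cst_mx Y) = cst_mx (Y *m X).
Proof.
apply/matrixP => i j; rewrite !mxE rmorph_sum; apply: eq_bigr => k _.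
by rewrite !mxE rmorphM mulrC.
Qed.

Context (I J : Type) (d : nat) (X : I + J -> 'M[R[i]]_d).

Definition constant_family (k : I + J) : linop (Xmx P d) :=
  match k with
  | inl _ => left_matrix (cst_mx (X k))
  | inr _ => right_matrix (cst_mx (X k))
  end.

Lemma constant_familyP : two_faced_matrices constant_family.
Proof. by split=> k; [exists (cst_mx (X (inl k)))|exists (cst_mx (X (inr k)))]. Qed.

(** On constant entries, applying the operators to the identity matrix just
    multiplies matrices of numbers, and the expectation does nothing. *)
Lemma constant_family_prod u :
  Phi_op (\prod_(k <- u) constant_family k) =
  normalized_trace (\prod_(k <- chi_order u) X k).
Proof.
suff E : ((\prod_(k <- u) constant_family k) : {linear Xmx P d -> Xmx P d}) 1%:M =
    cst_mx (\prod_(k <- chi_order u) X k).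
  rewrite /Phi_op; congr (normalized_trace _); apply/matrixP => i j.
  by rewrite mxE E mxE Linfm_expectation_cst.
elim: u => [|k u IH].
  rewrite /chi_order /= !big_nil /=.
  by rewrite /cst_mx map_mx1.
rewrite big_cons [LHS]/= IH; case: k => k.
  by rewrite /= left_matrix_cst /chi_order /= big_cons -mulmxE.
rewrite /= right_matrix_cst /chi_order /= rev_cons -rcons_cat -cats1.
by rewrite [in RHS]big_cat big_seq1 -mulmxE.
Qed.
End constant_entries.

(** * Bi-non-crossing sums and bi-free cumulants *)

Section bifree.
Context (I J : Type).

Lemma s_chi_inj n (chi : 'I_n -> I + J) : injective (s_chi chi).
Proof.
suff /image_injP inj : #|[seq s_chi chi i | i in 'I_n]| == #|'I_n| by move=> x y; exact: inj.
apply/eqP; rewrite [RHS]card_ord -[RHS]card_ord; apply: eq_card => i.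
by have [k <-] := s_chi_surj chi i; rewrite fintype.image_f.
Qed.

Lemma s_seqE n (chi : 'I_n -> I + J) : s_seq chi = map (s_chi chi) (enum 'I_n).
Proof.
have sz : size (s_seq chi) = n.
  rewrite size_cat size_rev !size_filter -[RHS]size_enum_ord.
  exact: count_predC.
case: n chi sz => [|n] chi sz; first by rewrite (size0nil sz) (size0nil (size_enum_ord 0)).
apply: (@eq_from_nth _ ord0) => [|i]; first by rewrite size_map size_enum_ord.
rewrite sz => lti; rewrite (nth_map ord0) ?size_enum_ord// /s_chi.
by rewrite nth_enum_ord//; apply: set_nth_default; rewrite sz.
Qed.

Lemma chi_order_map T (h : T -> I + J) (s : seq T) :
  chi_order (map h s) =
  map h ([seq k <- s | is_left (h k)] ++ rev [seq k <- s | ~~ is_left (h k)]).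
Proof. by rewrite /chi_order !filter_map map_cat map_rev. Qed.

Lemma chi_order_word n (chi : 'I_n -> I + J) :
  chi_order (map chi (enum 'I_n)) = map (chi \o s_chi chi) (enum 'I_n).
Proof. by rewrite chi_order_map map_comp -s_seqE. Qed.

(** Both sides enumerate the block s_chi (V) along s_chi, the increasing order
    of the left positions followed by the decreasing order of the right ones. *)
Lemma map_s_chi_block n (chi : 'I_n -> I + J) (V : {set 'I_n}) :
  let W := [set s_chi chi k | k in V] in
  map (s_chi chi) (enum V) =
  [seq k <- enum W | is_left (chi k)] ++ rev [seq k <- enum W | ~~ is_left (chi k)].
Proof.
have enumE (U : {set 'I_n}) : enum U = [seq k <- enum 'I_n | k \in U].
  by rewrite enumT.
have swap (p q : pred 'I_n) s : [seq k <- [seq k <- s | p k] | q k] =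
    [seq k <- [seq k <- s | q k] | p k].
  by rewrite -!filter_predI; apply: eq_filter => k /=; rewrite andbC.
move=> W; transitivity [seq k <- s_seq chi | k \in W].
  rewrite s_seqE filter_map (enumE V); congr map; apply: eq_filter => k /=.
  by rewrite mem_imset//; exact: s_chi_inj.
rewrite (enumE W) /s_seq filter_cat filter_rev.
by congr (_ ++ rev _); exact: swap.
Qed.

(** The permutation s_chi reverses the right letters and chi_order reverses them
    again, so they are back in their original order. *)
Lemma chi_order_block n (chi : 'I_n -> I + J) (V : {set 'I_n}) :
  let W := [set s_chi chi k | k in V] in
  chi_order [seq (chi \o s_chi chi) k | k <- enum V] =
  [seq k <- map chi (enum W) | is_left k] ++ [seq k <- map chi (enum W) | ~~ is_left k].
Proof.
move=> W; rewrite (map_comp chi (s_chi chi)) map_s_chi_block chi_order_map.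
rewrite !filter_cat !filter_rev.
have LR (s : seq 'I_n) : [seq k <- [seq k <- s | ~~ is_left (chi k)] | is_left (chi k)] = [::].
  by rewrite -filter_predI (eq_filter (a2 := pred0)) ?filter_pred0// => k /=; rewrite andbN.
have RL (s : seq 'I_n) : [seq k <- [seq k <- s | is_left (chi k)] | ~~ is_left (chi k)] = [::].
  by rewrite -filter_predI (eq_filter (a2 := pred0)) ?filter_pred0// => k /=; rewrite andNb.
by rewrite LR RL !filter_id cats0 revK map_cat !filter_map.
Qed.

Definition bnc_sum (C : comPzRingType) (c : seq (I + J) -> C) n (chi : 'I_n -> I + J) : C :=
  \sum_(pi in BNC chi) \prod_(V in pi) c (map chi (enum V)).

(** BNC(chi) is the image of NC(n) under s_chi, so a sum over it is a sum over NC(n)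
    for the word chi o s_chi; the hypothesis says that c sees only the order of
    the letters within each face, which is what survives in the blocks. *)
Lemma bnc_sumE (C : comPzRingType) (c : seq (I + J) -> C) n (chi : 'I_n -> I + J) :
  (forall u, c ([seq k <- u | is_left k] ++ [seq k <- u | ~~ is_left k]) = c u) ->
  bnc_sum c chi = nc_fun (c \o @chi_order I J) (chi_order (map chi (enum 'I_n))).
Proof.
move=> cE; rewrite chi_order_word nc_funE /bnc_sum /nc_sum /BNC big_imset; last first.
  by apply: in2W; apply: imset_inj; apply: imset_inj; exact: s_chi_inj.
apply: eq_bigr => pi _; rewrite big_imset; last first.
  by apply: in2W; apply: imset_inj; exact: s_chi_inj.
by apply: eq_bigr => V _; rewrite [RHS]/= chi_order_block cE.
Qed.

Lemma map_enum_val (T : finType) (A : {set T}) :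
  map enum_val (enum 'I_#|A|) = enum A.
Proof.
case: (set_0Vmem A) => [->|[x0 x0A]].
  by rewrite enum_set0; apply: size0nil; rewrite size_map size_enum_ord cards0.
apply: (@eq_from_nth _ x0) => [|i]; first by rewrite size_map size_enum_ord cardE.
rewrite size_map size_enum_ord => lti.
by rewrite (nth_map (Ordinal lti)) ?size_enum_ord// (enum_val_nth x0) nth_enum_ord.
Qed.

(** The moment-cumulant formula determines the cumulants: by induction all terms
    but that of the one-block partition agree. *)
Lemma bifree_cumulant_eq (R : realType) (B : pzRingType) (psi : B -> R[i])
    (z : I + J -> B) (c : seq (I + J) -> R[i]) :
  (forall n (chi : 'I_n -> I + J), (0 < n)%N ->
    psi (\prod_(k < n) z (chi k)) = bnc_sum c chi) ->
  forall n (chi : 'I_n -> I + J), (0 < n)%N ->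
    bifree_cumulant psi chi (z \o chi) = c (map chi (enum 'I_n)).
Proof.
move=> psiE; elim/ltn_ind => -[//|n] IH chi _.
rewrite /bifree_cumulant /= psiE// /bnc_sum.
rewrite (bigD1 [set [set: 'I_n.+1]]) ?BNC_setT//= big_set1 enum_setT -enumT.
rewrite -addrA -[RHS]addr0; congr (_ + _); apply/eqP; rewrite subr_eq0; apply/eqP.
apply: eq_bigr => pi /andP[piB piT]; apply: eq_bigr => V Vpi.
have /andP[V0 Vn] := BNC_card piB piT Vpi.
rewrite cumulant_rec_fuel//; have := IH #|V| Vn (chi \o enum_val) V0.
by rewrite (map_comp chi enum_val) map_enum_val.
Qed.

End bifree.

(** * Traciality and cyclic words in commuting faces *)

Local Open Scope classical_set_scope.

(** A limit of normalized traces is tracial; a single outcome at which the model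
    converges is enough. *)
Lemma model_trace (R : realType) (K : Type) (A : ncProbSpace R) (a : K -> A) :
  has_as_random_matrix_model a ->
  forall u v, nc_state A (\prod_(k <- u ++ v) a k) = nc_state A (\prod_(k <- v ++ u) a k).
Proof.
move=> [dO [Om [P [X [_ ae]]]]].
have [w Xw] : exists w, cvg_in_distribution (fun n => @normalized_trace R n)
        (fun n k => X n k w : 'M[R[i]]_n) (nc_state A) a.
  apply: contrapT => /forallNP no.
  have /negligibleP : P.-negligible setT by apply: negligibleS ae => w _; exact: no.
  move=> /(_ measurableT) P0; have := etrans (esym (probability_setT P)) P0.
  by move/eqP; rewrite onee_eq0.
have cvg_word u : (fun n => normalized_trace (\prod_(k <- u) X n k w) : R[i]^o) @ \oo
    --> (nc_state A (\prod_(k <- u) a k) : R[i]^o).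
  have := Xw _ (tnth (in_tuple u)); rewrite /moment prod_ord_word map_tnth_enum.
  by under eq_fun => n do rewrite (prod_ord_word (fun k => X n k w)) map_tnth_enum.
move=> u v; apply: (@norm_cvg_unique _ _ _ _ _ _ (cvg_word (u ++ v))).
suff -> : (fun n => normalized_trace (\prod_(k <- u ++ v) X n k w)) =
    fun n => normalized_trace (\prod_(k <- v ++ u) X n k w) by exact: cvg_word.
apply/funext => n.
by rewrite /normalized_trace !big_cat /= -!mulmxE mxtrace_mulC.
Qed.

Section commuting_faces.
Context (I J : Type) (B : pzRingType) (a : I + J -> B)
  (aC : forall i j, a (inl i) * a (inr j) = a (inr j) * a (inl i)).

Lemma commute_right_word i s :
  a (inl i) * \prod_(k <- s | ~~ is_left k) a k =
  \prod_(k <- s | ~~ is_left k) a k * a (inl i).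
Proof. by apply: commr_prod => -[//|j] _; exact: aC. Qed.

Lemma commute_left_word j s :
  a (inr j) * \prod_(k <- s | is_left k) a k =
  \prod_(k <- s | is_left k) a k * a (inr j).
Proof. by apply: commr_prod => -[i|//] _; exact/esym/aC. Qed.

Lemma prod_faces u :
  \prod_(k <- [seq k <- u | is_left k] ++ [seq k <- u | ~~ is_left k]) a k =
  \prod_(k <- u) a k.
Proof.
elim: u => [|[i|j] u IH]; first by [].
  by rewrite /= !big_cons IH.
rewrite /= big_cons -IH !big_cat big_cons /= !mulrA; congr (_ * _).
by rewrite big_filter commute_left_word.
Qed.

(** Moving the first letter of u to the end moves it, inside chi_order u, between
    one end of the product and the border of the two faces. As it commutes with
    the opposite face it can be carried from the border to the other end, and tau
    is cyclic. *)
Lemma trace_chi_order_cyclic (C : Type) (tau : B -> C) :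
  (forall u v, tau (\prod_(k <- u ++ v) a k) = tau (\prod_(k <- v ++ u) a k)) ->
  cyclic_fun (fun u => tau (\prod_(k <- chi_order u) a k)).
Proof.
move=> tauC [//|k u]; rewrite rot1_cons -cats1 /chi_order !filter_cat /=.
set l := [seq k <- u | is_left k]; set r := [seq k <- u | ~~ is_left k].
case: k => k /=; rewrite cats0 -?/l -?/r.
  rewrite -[RHS](tauC (l ++ rev r) [:: inl k]) -!catA !big_cat !big_seq1 /=.
  by rewrite -filter_rev [in LHS]big_filter [in RHS]big_filter commute_right_word.
rewrite rev_cat [in RHS]rev_cons -cats1 [in RHS]catA -[RHS](tauC [:: inr k]).
rewrite !big_cat !big_seq1 /= !mulrA.
by rewrite [in LHS]big_filter [in RHS]big_filter commute_left_word.
Qed.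
End commuting_faces.

(** * Convergence to the compound bi-free Poisson distribution *)

Theorem theorem4p4 (R : realType) (lambda : R) (N M : nat)
    (A : cstarProbSpace R) (a : 'I_N + 'I_M -> A) :
  0 < lambda ->
  (forall k, star (a k) = a k) ->
  has_as_random_matrix_model a ->
  (forall i j, a (inl i) * a (inr j) = a (inr j) * a (inl i)) ->
  exists (dO : measure_display) (Om : measurableType dO) (P : probability Om R)
         (alpha : nat -> nat)
         (Z : forall n, 'I_N + 'I_M -> linop (Xmx P (alpha n))),
    [/\ (forall n, (0 < alpha n)%N),
        {homo alpha : m n / (m < n)%N},
        (forall n, two_faced_matrices (Z n)) &
        exists (B : ncProbSpace R) (z : 'I_N + 'I_M -> B),
          has_compound_bifree_poisson z lambda a /\
          cvg_in_distribution (fun n => @Phi_op _ Om R P (alpha n)) Z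
            (nc_state B) z].
Proof.
move=> _ _ model aC.
(* The prescribed cumulants, and the trace moments that they generate once the
   right letters are reversed. *)
pose c u := real_complex R lambda * nc_state A (\prod_(k <- u) a k).
pose G := nc_fun (c \o @chi_order 'I_N 'I_M).
have Gc : cyclic_fun G.
  apply: nc_fun_cyclic => u; congr (_ * _).
  exact: (trace_chi_order_cyclic aC (model_trace model) u).
have G1 : G [::] = 1 := nc_fun_nil _.
pose alpha n := (n.+1 + realization_dim ('I_N + 'I_M)%type n)%N.
pose X n := sval (cid (normalized_trace_realization Gc G1 n)).
have XE n := svalP (cid (normalized_trace_realization Gc G1 n)).
pose Om : measurableType _ := unit.
exists _, Om, (dirac tt : probability Om R), alpha.
exists (fun n => constant_family _ (X n)); split=> //.
- apply: homo_ltn => [y x z|n]; first exact: ltn_trans.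
  by rewrite /alpha [X in (_ < X)%N]addSn ltnS leq_add2l realization_dimS.
- by move=> n; exact: constant_familyP.
pose mu u := G (chi_order u).
have mu1 : word_state mu 1 = 1 by exact: G1.
exists (NcProbSpace mu1), (@append_letter _ _); split=> [n chi n0|m w].
  rewrite [LHS](@bifree_cumulant_eq _ _ _ _ _ _ c)// => [|p rho p0].
    by rewrite /c /moment prod_ord_word.
  rewrite prod_ord_word [LHS]word_state_prod /mu bnc_sumE// => u.
  by rewrite /c (prod_faces aC).
(* The moments of length m are attained as soon as n >= m. *)
apply: cvg_near_cst; exists m => // n /= mn.
rewrite /moment !prod_ord_word [RHS]word_state_prod constant_family_prod /mu.
apply: XE; rewrite size_cat size_rev !size_filter count_predC.
by rewrite size_map size_enum_ord.
Qed.
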